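(* Let $\chi:\mathbb{R}\to\mathbb{R}$ be a kernel, let $f:\mathbb{R}\to\mathbb{R}$ be a bounded, locally integrable function with a (non-removable) jump discontinuity at $t\in\mathbb{R}$, and let $\alpha\in\mathbb{R}$. Then the following assertions are equivalent: (i) $\displaystyle\lim_{w\to+\infty,\ wt\in\mathbb{Z}}(S_wf)(t)=[\alpha+\chi(0)]\,f(t+0)+[1-\alpha-\chi(0)]\,f(t-0)$; (ii) $\Psi^-_\chi(0)=\alpha$; (iii) $\Psi^+_\chi(0)=1-\alpha-\chi(0)$.
   Context: A function $\chi:\mathbb{R}\to\mathbb{R}$ is called a kernel if: (1) $\chi\in L^1(\mathbb{R})$ and $\chi$ is bounded on $[-1,1]$; (2) $\sum_{k\in\mathbb{Z}}\chi(u-k)=1$ for every $u\in\mathbb{R}$; (3) for some $\beta>0$, $m_\beta(\chi):=\sup_{u\in\mathbb{R}}\sum_{k\in\mathbb{Z}}|\chi(u-k)|\,|u-k|^\beta<+\infty$. For a kernel $\chi$ and $w>0$, the sampling Kantorovich operator is $(S_wf)(t):=\sum_{k\in\mathbb{Z}}\chi(wt-k)\left[w\int_{k/w}^{(k+1)/w}f(u)\,du\right]$, $t\in\mathbb{R}$, for locally integrable $f:\mathbb{R}\to\mathbb{R}$ such that the series converges for each $t\in\mathbb{R}$ (this holds for bounded measurable $f$). Notation: $f(t\pm0):=\lim_{\varepsilon\to0^+}f(t\pm\varepsilon)$; a (non-removable) jump discontinuity at $t$ means that both limits $f(t+0)$, $f(t-0)$ exist and are finite and $f(t+0)\neq f(t-0)$.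 For $x\in\mathbb{R}$, $\Psi^+_\chi(x):=\sum_{k\in\mathbb{Z},\,k<x}\chi(x-k)$ and $\Psi^-_\chi(x):=\sum_{k\in\mathbb{Z},\,k>x}\chi(x-k)$. The limit in (i) is taken as $w\to+\infty$ along those $w>0$ with $wt\in\mathbb{Z}$. *)

(* Defs.v *)
From mathcomp Require Import all_boot all_order all_algebra.
From mathcomp Require Import all_classical all_reals all_analysis.

Set Implicit Arguments.
Unset Strict Implicit.
Unset Printing Implicit Defensive.

Import Order.TTheory GRing.Theory Num.Theory.
Import numFieldNormedType.Exports.

Local Open Scope classical_set_scope.
Local Open Scope ring_scope.

Section bilateral_series.
Context {R : realType}.
Implicit Types a : int -> R.

(* [Negz n] is the integer -(n + 1). *)
Definition zsummable a : Prop :=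
  cvgn (series (fun n : nat => a (Posz n))) /\
  cvgn (series (fun n : nat => a (Negz n))).

(* Meaningful only when [zsummable a] holds. *)
Definition zsum a : R :=
  limn (series (fun n : nat => a (Posz n))) +
  limn (series (fun n : nat => a (Negz n))).

End bilateral_series.

(* The completed measure is used so that "measurable" means Lebesgue
   measurable; [lebesgue_measure] lives on the Borel sigma-algebra only, and
   the library's [locally_integrable] refers to it. *)
Section sampling_kantorovich.
Context {R : realType}.
Implicit Types (chi f : R -> R) (w t u x beta : R).

Local Notation mu := (@completed_lebesgue_measure R).

Definition abs_moment beta chi : \bar R :=
  ereal_sup [set (\esum_(k in [set: int])
      (`|chi (u - k%:~R)| * `|u - k%:~R| `^ beta)%:E)%E | u in [set: R]].

Definition is_kernel chi : Prop :=
  [/\ mu.-integrable [set: R] (EFin \o chi) /\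
        [bounded chi u | u in `[-1, 1]%classic],
      forall u, zsummable (fun k => chi (u - k%:~R)) /\
        zsum (fun k => chi (u - k%:~R)) = 1
    & exists2 beta, 0 < beta & (abs_moment beta chi < +oo)%E].

Definition loc_integrable f : Prop :=
  forall K : set R, compact K -> mu.-integrable K (EFin \o f).

Definition sampling_kantorovich chi w f t : R :=
  zsum (fun k => chi (w * t - k%:~R) *
    (w * \int[mu]_(u in `[k%:~R / w, (k%:~R + 1) / w]%classic) f u)).

Definition right_limit f t : R := lim (f x @[x --> t^'+]).

Definition left_limit f t : R := lim (f x @[x --> t^'-]).

Definition jump_discontinuity f t : Prop :=
  [/\ cvg (f x @[x --> t^'+]), cvg (f x @[x --> t^'-])
    & right_limit f t <> left_limit f t].

Definition Psi_plus chi x : R :=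
  zsum (fun k => if k%:~R < x then chi (x - k%:~R) else 0).

Definition Psi_minus chi x : R :=
  zsum (fun k => if x < k%:~R then chi (x - k%:~R) else 0).

End sampling_kantorovich.

(* Main.v *)
Require Import Defs.
From mathcomp Require Import all_boot all_order all_algebra.
From mathcomp Require Import all_classical all_reals all_analysis.
From mathcomp Require Import ring lra zify.

(* If w t is the integer m, the substitution k = m + j turns S_w f (t) into the
   sum over j of chi(-j) times the mean of f over [t + j/w, t + (j+1)/w].  As
   w grows these means tend to f(t+0) for j >= 0 and to f(t-0) for j < 0, while
   the finite moment makes the weights chi(-j) absolutely summable, so dominated
   convergence gives the limit P f(t+0) + N f(t-0), where P and N are the sums
   of the weights over j >= 0 and j < 0.  Since P + N = 1, P = Psi_minus(0) +
   chi(0), N = Psi_plus(0) and f(t+0) <> f(t-0), the three assertions agree. *)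

Import Order.TTheory GRing.Theory Num.Theory.
Import numFieldNormedType.Exports.

Local Open Scope classical_set_scope.
Local Open Scope ring_scope.

(** * Reindexing of bilateral series *)

Section bilateral_series.
Context {R : realType}.
Implicit Types (a b c : int -> R).

(* The reflection k |-> - 1 - k exchanges [Posz n] and [Negz n]. *)
Lemma zsum_reflect a : zsum (fun k => a (- 1 - k)) = zsum a.
Proof.
rewrite /zsum addrC; congr (limn (series _) + limn (series _)).
  by apply/funext => n; congr (a _); lia.
by apply/funext => n; congr (a _); lia.
Qed.

Lemma zsummable_reflect a : zsummable a -> zsummable (fun k => a (- 1 - k)).
Proof.
move=> [cp cn]; split.
  have -> // : (fun n : nat => a (- 1 - Posz n)) = (fun n => a (Negz n)).
  by apply/funext => n; congr (a _); lia.
have -> // : (fun n : nat => a (- 1 - Negz n)) = (fun n => a (Posz n)).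
by apply/funext => n; congr (a _); lia.
Qed.

Lemma cvg_seriesMr (u : nat -> R) (r l : R) : series u @ \oo --> l ->
  series (fun n => u n * r) @ \oo --> l * r.
Proof.
move=> ul.
have -> : series (fun n => u n * r) = fun n => series u n * r.
  by apply/funext => n; rewrite /series /= mulr_suml.
exact: cvgMr_tmp.
Qed.

Lemma zsummableMr a (r : R) : zsummable a -> zsummable (fun k => a k * r).
Proof.
move=> [/(cvg_seriesMr _ r) cp /(cvg_seriesMr _ r) cn].
by split; [exact: cvgP cp | exact: cvgP cn].
Qed.

Lemma cvg_series_shift (u : nat -> R) (l : R) :
  series u @ \oo --> l -> series (fun n => u n.+1) @ \oo --> l - u 0%N.
Proof.
move=> ul.
have -> : series (fun n => u n.+1) = fun n => series u n.+1 - u 0%N.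
  apply/funext => n; rewrite /series /= big_nat_recl//=.
  by rewrite addrAC subrr add0r.
apply: cvgB; last exact: cvg_cst.
by rewrite (@cvg_shiftS _ (series u)).
Qed.

Lemma cvg_series_cons (u : nat -> R) (x l : R) : series u @ \oo --> l ->
  series (fun n => if n is m.+1 then u m else x) @ \oo --> x + l.
Proof.
move=> ul; rewrite -cvg_shiftS.
have -> : [sequence series (fun n => if n is m.+1 then u m else x) n.+1]_n =
    (fun n => x + series u n).
  by apply/funext => n; rewrite /series /= big_nat_recl.
by apply: cvgD => //; exact: cvg_cst.
Qed.

(** The shift moves the term [a 0] from the nonnegative half to the negative one, so the two limits
    change by [- a 0] and [+ a 0]. *)
Lemma zsum_succ a : zsummable a ->
  zsummable (fun k => a (k + 1)) /\ zsum (fun k => a (k + 1)) = zsum a.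
Proof.
move=> [cp cn].
have pos := @cvg_series_shift (fun n => a (Posz n)) _ cp.
have neg := @cvg_series_cons (fun n => a (Negz n)) (a 0) _ cn.
have posE : (fun n : nat => a (Posz n + 1)) = (fun n => a (Posz n.+1)).
  by apply/funext => n; congr (a _); lia.
have negE : (fun n : nat => a (Negz n + 1)) =
    (fun n => if n is m.+1 then a (Negz m) else a 0).
  by apply/funext => -[|n]; congr (a _); lia.
split; first by split; rewrite ?posE ?negE; apply/cvg_ex;
  [exists (limn (series (fun n => a (Posz n))) - a 0) |
   exists (a 0 + limn (series (fun n => a (Negz n))))].
rewrite /zsum posE negE (cvg_lim _ pos)// (cvg_lim _ neg)//; ring.
Qed.

(** Conjugating the shift [k + 1] by the reflection [- 1 - k] gives the shift [k - 1]. *)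
Lemma zsum_pred a : zsummable a ->
  zsummable (fun k => a (k - 1)) /\ zsum (fun k => a (k - 1)) = zsum a.
Proof.
move=> /zsummable_reflect/zsum_succ[/zsummable_reflect].
rewrite -(zsum_reflect (fun k => a (- 1 - (k + 1)))) zsum_reflect.
have -> : (fun k => a (- 1 - (- 1 - k + 1))) = (fun k => a (k - 1)) => //.
by apply/funext => k; congr (a _); lia.
Qed.

Lemma zsum_shift a (m : int) : zsummable a ->
  zsummable (fun k => a (k + m)) /\ zsum (fun k => a (k + m)) = zsum a.
Proof.
elim/int_ind: m => [|m IH|m IH] /[dup] za.
- by have -> : (fun k => a (k + 0)) = a
    by apply/funext => k; rewrite addr0.
- move=> /IH[/zsum_succ[+ +] <-].
  have -> // : (fun k : int => a (k + 1 + m%:Z)) = (fun k => a (k + m.+1%:Z)).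
  by apply/funext => k; congr (a _); lia.
- move=> /IH[/zsum_pred[+ +] <-].
  have -> // : (fun k : int => a (k - 1 - m%:Z)) = (fun k => a (k - m.+1%:Z)).
  by apply/funext => k; congr (a _); lia.
Qed.

Lemma zsummable_dominated a b : (forall k, `|a k| <= b k) ->
  zsummable b -> zsummable a.
Proof.
move=> ab [bp bn]; split; apply: normed_cvg => /=; [move: bp|move: bn];
  apply: series_le_cvg => n;
  [exact: normr_ge0|exact: le_trans (normr_ge0 _) (ab _)|exact: ab
  |exact: normr_ge0|exact: le_trans (normr_ge0 _) (ab _)|exact: ab].
Qed.

(** * Dominated convergence of series along a proper filter *)

Section dominated.
Context {T : Type} {F : set_system T} {FF : ProperFilter F}.

(** Tannery's theorem: cut the series at an index past which [v] has a small tail. The finite head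
    converges term by term, and the rest costs at most twice that tail, since both [u w] and [l] are
    bounded by [v]. *)
Lemma cvg_series_dominated (u : T -> nat -> R) (v l : nat -> R) :
    cvgn (series v) -> (\forall w \near F, forall n, `|u w n| <= v n) ->
    (forall n, u w n @[w --> F] --> l n) ->
  limn (series (u w)) @[w --> F] --> limn (series l).
Proof.
move=> cv uv ul.
have lv n : `|l n| <= v n.
  rewrite -(cvg_lim _ (cvg_norm (ul n)))//; apply: limr_le.
    exact: cvgP (cvg_norm (ul n)).
  by apply: filterS uv => w; exact.
have v_ge0 n : 0 <= v n by exact: le_trans (lv n).
have sv_homo : {homo series v : n m / (n <= m)%N >-> n <= m}.
  by apply: nondecreasing_series => n _ _.
have sum_normB w n : (forall k, `|u w k| <= v k) ->
    `|limn (series (u w)) - limn (series l)| <=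
    \sum_(0 <= k < n) `|u w k - l k| + 2 * (limn (series v) - series v n).
  move=> uwv.
  have cvg_le (g : nat -> R) : (forall k, `|g k| <= v k) -> cvgn (series g).
    by move=> gv; apply: normed_cvg; apply: series_le_cvg cv => k //=.
  have cB : (series (u w) m - series l m) @[m --> \oo] -->
            limn (series (u w)) - limn (series l).
    by apply: cvgB; exact: cvg_le.
  apply: (ler_cvg_to (cvg_norm cB) (cvg_cst _)); near=> m.
  have nm : (n <= m)%N by near: m; exact: nbhs_infty_ge.
  rewrite /series /= -sumrB (big_cat_nat (leq0n n) nm)//=.
  apply: (le_trans (ler_normD _ _)); apply: lerD; first exact: ler_norm_sum.
  apply: (le_trans (ler_norm_sum _ _ _)).
  apply: (@le_trans _ _ (2 * (series v m - series v n))); last first.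
    by rewrite ler_pM2l// lerB// nondecreasing_cvgn_le.
  rewrite sub_series_geq// mulr_sumr; apply: ler_sum => k _.
  apply: (le_trans (ler_normB _ _)).
  by rewrite mulr_natl mulr2n lerD.
apply/cvgrPdist_le => e e0.
(* The tail is counted twice, so [e / 4] leaves [e / 2] for the head. *)
have /cvgrPdist_le/(_ (e / 4)) := cv.
rewrite divr_gt0// => /(_ isT)[N _ /(_ N (leqnn N)) /= vN].
have : \sum_(0 <= k < N) `|u w k - l k| @[w --> F] -->
       \sum_(0 <= k < N) (0 : R).
  apply: (@cvg_big _ _ +%R) => [|k _]; first exact: add_continuous.
  rewrite -(normr0 R); apply: cvg_norm.
  by rewrite -(subrr (l k)); apply: cvgB => //; exact: cvg_cst.
rewrite big1// => /cvgr_norm_le/(_ (e / 2)); rewrite normr0 divr_gt0//.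
move=> /(_ isT); apply: filterS2 uv => w uwv dN.
rewrite distrC; apply: (le_trans (sum_normB w N uwv)).
have := le_trans (ler_norm _) dN; have := le_trans (ler_norm _) vN; lra.
Unshelve. all: by end_near. Qed.

Lemma cvg_zsum_dominated (a : T -> int -> R) b c : zsummable b ->
    (\forall w \near F, forall k, `|a w k| <= b k) ->
    (forall k, a w k @[w --> F] --> c k) ->
  zsum (a w) @[w --> F] --> zsum c.
Proof.
move=> [bp bn] ab ac; apply: cvgD.
  apply: (cvg_series_dominated (fun w n => a w (Posz n))
    (fun n => b (Posz n)) (fun n => c (Posz n)) bp) => //.
  by apply: filterS ab => w ab n; exact: ab.
apply: (cvg_series_dominated (fun w n => a w (Negz n))
  (fun n => b (Negz n)) (fun n => c (Negz n)) bn) => //.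
by apply: filterS ab => w ab n; exact: ab.
Qed.
End dominated.
End bilateral_series.

(** * Means of [f] over short intervals near [t] *)

Local Notation sampling_mean f t w r :=
  (w * \int[completed_lebesgue_measure]_(x in `[t + r / w, t + (r + 1) / w]) f x).

Section means.
Context {R : realType}.
Implicit Types (f : R -> R) (a b l e w t : R).
Local Notation mu := (@completed_lebesgue_measure R).

(* The type carrying the sigma-algebra of Lebesgue measurable sets. *)
Let cara := caratheodory_type (R := R) (T := ocitv_type R) (wlength idfun)^*%mu.

Lemma cara_measurable_itv (i : interval R) : measurable ([set` i] : set cara).
Proof. by apply: sub_caratheodory; exact: measurable_itv. Qed.

Lemma completed_lebesgue_measure_itv (i : interval R) :
  mu [set` i] = lebesgue_measure [set` i].
Proof. by []. Qed.

Lemma completed_lebesgue_measure_set1 (x : R) : mu [set x] = 0%E.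
Proof. exact: (@lebesgue_measure_set1 R). Qed.

(** The bound is asked only on the open interval: an endpoint may be the jump point itself, where
    one-sided limits say nothing about the value of [f]. *)
Lemma normr_mean_le f a b l e : loc_integrable f -> a < b ->
    (forall x, a < x < b -> `|f x - l| <= e) ->
  `|(b - a)^-1 * \int[mu]_(x in `[a, b]) f x - l| <= e.
Proof.
move=> loc_f ab fl.
have mI : measurable (`[a, b] : set cara) by exact: cara_measurable_itv.
have mO : measurable (`]a, b[ : set cara) by exact: cara_measurable_itv.
have If : mu.-integrable `[a, b] (EFin \o f) by apply: loc_f; exact: segment_compact.
have ba0 : 0 < b - a by rewrite subr_gt0.
have mu_oo : mu `]a, b[ = (b - a)%:E.
  rewrite completed_lebesgue_measure_itv lebesgue_measure_itv/= lte_fin ab.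
  by rewrite EFinN EFinB.
have mu_lty : (mu `]a, b[ < +oo)%E by rewrite mu_oo ltry.
have oo_cc : (`]a, b[ : set R) `<=` `[a, b] by exact: subset_itv_oo_cc.
have Ifo : mu.-integrable `]a, b[ (EFin \o f) by exact: integrableS If.
have Ic (c : R) : mu.-integrable `]a, b[ (EFin \o cst c).
  apply: measurable_bounded_integrable => //.
  exists `|c|; split; first exact: num_real.
  by move=> M cM x _; exact: ltW.
have int_cst c : \int[mu]_(x in `]a, b[) c = c * (b - a).
  rewrite (Rintegral_cst mu mO c); congr (_ * _).
  by have /= := congr1 (@fine R) mu_oo.
(* The two domains differ by the null set of the endpoints. *)
have -> : \int[mu]_(x in `[a, b]) f x = \int[mu]_(x in `]a, b[) f x.
  have -> : `]a, b[%classic = `[a, b] `\` [set a; b].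
    apply/seteqP; split => x /=; rewrite !in_itv/=; first lra.
    move=> [/andP[ax xb]] /not_orP[/eqP xa /eqP xb'].
    by rewrite !lt_neqAle ax xb xb' eq_sym xa.
  rewrite /Rintegral; congr fine; apply: negligible_integral => //.
    by apply: measurableU; apply: sub_caratheodory; exact: measurable_set1.
  apply: null_set_setU; try exact: completed_lebesgue_measure_set1.
    by apply: sub_caratheodory; exact: measurable_set1.
  by apply: sub_caratheodory; exact: measurable_set1.
have IB : mu.-integrable `]a, b[ (EFin \o (fun x => f x - l)).
  have IB := integrableB mO Ifo (Ic l).
  apply: eq_integrable IB => // x _.
(* The constant [l] is its own mean, so it can be moved under the integral. *)
have -> : (b - a)^-1 * \int[mu]_(x in `]a, b[) f x - l =
    (b - a)^-1 * \int[mu]_(x in `]a, b[) (f x - l).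
  rewrite RintegralB//; last exact: Ic.
  by rewrite int_cst; field; lra.
rewrite normrM gtr0_norm ?invr_gt0// ler_pdivrMl//.
apply: (@le_trans _ _ (\int[mu]_(x in `]a, b[) `|f x - l|)).
  exact: le_normr_Rintegral mO IB.
apply: (@le_trans _ _ (\int[mu]_(x in `]a, b[) e)).
  apply: (le_Rintegral mO (integrable_norm IB) (Ic e)).
  by move=> x /=; rewrite in_itv/=; exact: fl.
by rewrite int_cst mulrC.
Qed.

Lemma normr_sampling_mean_le f t w (r : R) l e : loc_integrable f -> 0 < w ->
    (forall x, t + r / w < x < t + (r + 1) / w -> `|f x - l| <= e) ->
  `|sampling_mean f t w r - l| <= e.
Proof.
move=> loc_f w0 fl.
have wE : w = (t + (r + 1) / w - (t + r / w))^-1.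
  by rewrite (_ : t + _ - _ = w^-1) ?invrK//; field; lra.
rewrite [X in `|X * _ - _|]wE; apply: normr_mean_le => //.
by rewrite ltrD2l ltr_pM2r ?invr_gt0//; lra.
Qed.

(** For [r >= 0] the open interval of integration lies to the right of [t], and within distance [d]
    of it as soon as [(r + 1) / w < d]. *)
Lemma cvg_sampling_mean_right f t (r : R) : loc_integrable f ->
    cvg (f x @[x --> t^'+]) -> 0 <= r ->
  sampling_mean f t w r @[w --> +oo] --> right_limit f t.
Proof.
move=> loc_f cf r0; apply/cvgrPdist_le => e e0.
have /cvgrPdist_le/(_ e e0)[d /= d0 fd] := cf.
near=> w.
have w0 : 0 < w by near: w; apply: nbhs_pinfty_gt; exact: num_real.
have rwd : (r + 1) / w < d.
  rewrite ltr_pdivrMr// mulrC -ltr_pdivrMr//; near: w.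
  by apply: nbhs_pinfty_gt; exact: num_real.
rewrite distrC; apply: normr_sampling_mean_le => // x /andP[tx xt].
rewrite distrC; have r0w : 0 <= r / w by rewrite divr_ge0// ltW.
by apply: fd; [rewrite /ball/= ltr_norml; lra | lra].
Unshelve. all: by end_near. Qed.

(** The condition [r + 1 <= 0] puts the right endpoint at or before [t]; the left endpoint is the
    far one, hence the requirement [- r / w < d]. *)
Lemma cvg_sampling_mean_left f t (r : R) : loc_integrable f ->
    cvg (f x @[x --> t^'-]) -> r + 1 <= 0 ->
  sampling_mean f t w r @[w --> +oo] --> left_limit f t.
Proof.
move=> loc_f cf r0; apply/cvgrPdist_le => e e0.
have /cvgrPdist_le/(_ e e0)[d /= d0 fd] := cf.
near=> w.
have w0 : 0 < w by near: w; apply: nbhs_pinfty_gt; exact: num_real.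
have rwd : - r / w < d.
  rewrite ltr_pdivrMr// mulrC -ltr_pdivrMr//; near: w.
  by apply: nbhs_pinfty_gt; exact: num_real.
rewrite distrC; apply: normr_sampling_mean_le => // x /andP[tx xt].
rewrite distrC; have r0w : (r + 1) / w <= 0 by rewrite pmulr_lle0 ?invr_gt0.
by apply: fd; [rewrite /ball/= ltr_norml; lra | lra].
Unshelve. all: by end_near. Qed.
End means.

(** * Absolute summability of the weights, and the filter of admissible [w] *)

Section kernel.
Context {R : realType}.
Implicit Types (chi : R -> R).

(** By injectivity of [e], the series is bounded by the part of the unordered sum of [a] over the
    image of [e]. *)
Lemma cvg_series_esum_lty {T : choiceType} (a : T -> \bar R)
    (e : nat -> T) (u : nat -> R) : injective e ->
    (forall k, (0 <= a k)%E) -> (\esum_(k in [set: T]) a k < +oo)%E ->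
    (forall n, 0 <= u n) -> (forall n, ((u n)%:E <= a (e n))%E) ->
  cvgn (series u).
Proof.
move=> inj_e a0 alty u0 ua; apply: nnseries_is_cvg => //.
apply: le_lt_trans alty; rewrite nneseries_esumT; last by move=> n; rewrite lee_fin.
apply: (@le_trans _ _ (\esum_(n in [set: nat]) a (e n))); first exact: le_esum.
rewrite -(@esum_image _ _ _ setT e a); last by move=> x y _ _; exact: inj_e.
by apply: le_ereal_sup => _ [X [finX _] <-]; exists X.
Qed.

(** For [k != 0] the factor [|k| ^ beta] is at least 1, so the moment at [u = 0] bounds the sum of
    these terms. *)
Lemma kernel_abs_summable chi : is_kernel chi ->
  zsummable (fun k => `|chi (0 - k%:~R)|).
Proof.
move=> [_ _ [beta beta0 mom]].
pose a (k : int) : \bar R := (`|chi (0 - k%:~R)| * `|0 - k%:~R| `^ beta)%:E.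
have a0 k : (0 <= a k)%E by rewrite lee_fin mulr_ge0// powR_ge0.
have alty : (\esum_(k in [set: int]) a k < +oo)%E.
  by apply: le_lt_trans mom; apply: ereal_sup_ubound; exists 0.
have chi_le (k : int) : k != 0 -> (`|chi (0 - k%:~R)|%:E <= a k)%E.
  move=> k0; rewrite lee_fin ler_peMr//.
  have k1 : 1 <= `|0 - k%:~R| :> R.
    by rewrite sub0r normrN -intr_norm ler1z -gtz0_ge1 normr_gt0.
  have := ge0_ler_powR (ltW beta0) _ _ k1; rewrite powR1; apply;
    by rewrite nnegrE.
split; last first.
  by apply: (@cvg_series_esum_lty _ a Negz) => // [? ? []//|n]; exact: chi_le.
(* The moment gives no control at [k = 0], where its factor vanishes; that single term is prepended
   afterwards. *)
have : cvgn (series (fun n => `|chi (0 - n.+1%:~R)|)).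
  apply: (@cvg_series_esum_lty _ a (fun n => Posz n.+1)) => // [? ? []//|n].
  exact: chi_le.
move=> /(@cvg_series_cons _ _ `|chi (0 - 0%:~R)|)/cvgP.
have -> // : (fun n => if n is m.+1 then `|chi (0 - m.+1%:~R)|
                       else `|chi (0 - 0%:~R)|) =
    (fun n : nat => `|chi (0 - n%:~R)|) by apply/funext => -[].
Qed.

(** Arbitrarily large [w] with [w * t] an integer exist, so the limit in (i) is not vacuous and is
    unique. *)
Lemma within_pinfty_int_proper (t : R) :
  ProperFilter (within [set w : R | 0 < w /\ w * t \is a Num.int]
                        (pinfty_nbhs R)).
Proof.
apply: Build_ProperFilter_ex => P [M [_ MP]].
have [t0|t0] := eqVneq t 0.
  exists (Num.max M 0 + 1); apply: MP => /=.
    by rewrite (@le_lt_trans _ _ (Num.max M 0)) ?le_max ?lexx// ltrDl.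
  split; last by rewrite t0 mulr0 int_num0.
  by rewrite (@le_lt_trans _ _ (Num.max M 0)) ?le_max ?lexx ?orbT// ltrDl.
(* With this [n], the point [n / |t|] exceeds [M], and its product with [t] is [n] or [- n]. *)
pose n := (Num.truncn (`|M| * `|t|)).+1.
have nt : `|M| * `|t| < n%:R by exact: truncnS_gt.
exists (n%:R / `|t|); apply: MP => /=.
  rewrite ltr_pdivlMr ?normr_gt0//; apply: le_lt_trans nt.
  by rewrite ler_wpM2r// ler_norm.
split; first by rewrite divr_gt0 ?normr_gt0// ltr0n.
have [tp|tn] := ltP 0 t.
  by rewrite gtr0_norm// divfK// ?natr_int.
by rewrite ler0_norm// invrN mulrN mulNr divfK// rpredN natr_int.
Qed.
End kernel.

(** * The limit of the operator at [t] *)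

Section limit.
Context {R : realType}.
Implicit Types (chi f : R -> R).

Lemma normr_sampling_mean_bound f (M w t r : R) :
    loc_integrable f -> (forall x, `|f x| <= M) -> 0 < w ->
  `|sampling_mean f t w r| <= M.
Proof.
move=> loc_f fM w0; rewrite -[X in `|X|]subr0.
by apply: normr_sampling_mean_le => // x _; rewrite subr0.
Qed.

(** Since [w * t = m], the left side is the series on the right shifted by [- m]. Boundedness of [f]
    makes the latter summable, as the shift requires. *)
Lemma sampling_kantorovich_shift chi f (M w t : R) (m : int) :
    is_kernel chi -> loc_integrable f -> (forall x, `|f x| <= M) ->
    0 < w -> w * t = m%:~R ->
  sampling_kantorovich chi w f t =
  zsum (fun k => chi (0 - k%:~R) * sampling_mean f t w k%:~R).
Proof.
move=> chi_kernel loc_f fM w0 wtm.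
pose b (k : int) := chi (0 - k%:~R) * sampling_mean f t w k%:~R.
have zb : zsummable b.
  apply: (@zsummable_dominated _ _ (fun k => `|chi (0 - k%:~R)| * M)).
    by move=> k; rewrite normrM ler_wpM2l// normr_sampling_mean_bound.
  by apply: zsummableMr; exact: kernel_abs_summable.
rewrite -[RHS](zsum_shift b (- m) zb).2 /sampling_kantorovich.
congr zsum; apply/funext => k; rewrite /b intrD intrN -wtm.
have -> : t + (k%:~R - w * t) / w = k%:~R / w by field; lra.
have -> : t + (k%:~R - w * t + 1) / w = (k%:~R + 1) / w by field; lra.
by congr (chi _ * _); ring.
Qed.

Lemma cvg_sampling_kantorovich chi f (t : R) :
    is_kernel chi -> bounded_fun f -> loc_integrable f ->
    cvg (f x @[x --> t^'+]) -> cvg (f x @[x --> t^'-]) ->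
  sampling_kantorovich chi w f t
    @[w --> within [set w : R | 0 < w /\ w * t \is a Num.int]
                   (pinfty_nbhs R)] -->
  limn (series (fun n : nat => chi (0 - (Posz n)%:~R))) * right_limit f t +
  limn (series (fun n : nat => chi (0 - (Negz n)%:~R))) * left_limit f t.
Proof.
move=> chi_kernel f_bnd loc_f fr fl.
have [M0 [_ fM0]] := f_bnd.
(* [bounded_fun] only provides bounds strictly above [M0]. *)
pose M := M0 + 1.
have fM x : `|f x| <= M by apply: fM0 => //; rewrite /M ltrDl.
have FF := within_pinfty_int_proper t.
set F := within _ _ in FF *.
have nearF : \forall w \near F, 0 < w /\ w * t \is a Num.int.
  exact: withinT.
have [_ /(_ 0)[[cp cn] _] _] := chi_kernel.
(* These are the termwise limits; the test [0 <= k] matches the [Posz]/[Negz] split of [zsum], so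
   each half has a constant factor. *)
pose c (k : int) := chi (0 - k%:~R) *
  (if 0 <= k then right_limit f t else left_limit f t).
have -> : limn (series (fun n : nat => chi (0 - (Posz n)%:~R))) * right_limit f t +
  limn (series (fun n : nat => chi (0 - (Negz n)%:~R))) * left_limit f t = zsum c.
  have cP := cvg_seriesMr _ (right_limit f t) _ cp.
  have cN := cvg_seriesMr _ (left_limit f t) _ cn.
  by rewrite /zsum (cvg_lim _ cP)// (cvg_lim _ cN).
apply: (@cvg_trans _
  (zsum (fun k : int => chi (0 - k%:~R) * sampling_mean f t w k%:~R) @[w --> F])).
  apply: near_eq_cvg; apply: filterS nearF => w [w0 /intrP[m wtm]].
  by rewrite (sampling_kantorovich_shift _ _ M _ _ m).
apply: (cvg_zsum_dominated (fun w k => chi (0 - k%:~R) * sampling_mean f t w k%:~R)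
  (fun k => `|chi (0 - k%:~R)| * M)).
- by apply: zsummableMr; exact: kernel_abs_summable.
- apply: filterS nearF => w [w0 _] k.
  by rewrite normrM ler_wpM2l// normr_sampling_mean_bound.
- move=> k; apply: cvgMl_tmp.
  (* The means converge along all [w] going to infinity, hence along the finer filter [F]. *)
  have FG : F `=>` pinfty_nbhs R by exact: cvg_within.
  case: ifPn => k0; apply: cvg_trans (cvg_app _ FG) _.
    by apply: cvg_sampling_mean_right => //; rewrite ler0z.
  by apply: cvg_sampling_mean_left => //; rewrite -(intrD _ k 1) lerz0; lia.
Qed.

End limit.

Theorem theorem2p7 (R : realType) (chi f : R -> R) (t alpha : R)
    (chi_kernel : is_kernel chi)
    (f_bounded : bounded_fun f)
    (f_loc : loc_integrable f)
    (f_jump : jump_discontinuity f t) :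
  [<-> sampling_kantorovich chi w f t
         @[w --> within [set w : R | 0 < w /\ w * t \is a Num.int]
                        (pinfty_nbhs R)] -->
         (alpha + chi 0) * right_limit f t +
         (1 - alpha - chi 0) * left_limit f t;
       Psi_minus chi 0 = alpha;
       Psi_plus chi 0 = 1 - alpha - chi 0].
Proof.
have [fr fl jump] := f_jump.
have S_cvg := cvg_sampling_kantorovich chi f t chi_kernel f_bounded f_loc fr fl.
have FF := within_pinfty_int_proper t.
have [_ /(_ 0)[[cp cn] sum1] _] := chi_kernel.
move: S_cvg sum1; rewrite /zsum.
set P := limn (series (fun n : nat => chi (0 - (Posz n)%:~R))).
set N := limn (series (fun n : nat => chi (0 - (Negz n)%:~R))) => S_cvg sum1.
have series0 : limn (series (fun _ : nat => 0 : R)) = 0.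
  by apply: lim_near_cst => //; apply: nearW => n; rewrite /series /= big1.
have Psi_plusE : Psi_plus chi 0 = N.
  rewrite /Psi_plus /zsum -[RHS]add0r -[X in X + N]series0.
  congr (limn (series _) + limn (series _)).
    by apply/funext => n; rewrite ltrz0.
  by apply/funext => n; rewrite ltrz0.
have Psi_minusE : Psi_minus chi 0 = P - chi 0.
  rewrite /Psi_minus /zsum -[RHS]addr0 -[X in _ = _ + X]series0.
  congr (_ + limn (series _)); last first.
    by apply/funext => n; rewrite ltr0z.
  apply: cvg_lim => //.
  (* Replacing the term at [k = 0] by zero amounts to dropping it and prepending 0, which lowers the
     limit [P] by [chi 0]. *)
  have tail := @cvg_series_shift _ (fun n : nat => chi (0 - (Posz n)%:~R)) _ cp.
  have -> : (fun n : nat => if 0 < (Posz n)%:~R :> R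
                            then chi (0 - (Posz n)%:~R) else 0) =
      (fun n => if n is m.+1 then chi (0 - (Posz m.+1)%:~R) else 0).
    by apply/funext => -[|n]; rewrite ltr0z.
  by have := cvg_series_cons _ 0 _ tail; rewrite add0r subr0.
rewrite Psi_plusE Psi_minusE; tfae.
(* By uniqueness of the limit the two expressions agree. With [N = 1 - P] their difference factors
   through the jump, which is nonzero. *)
- move=> S_cvg'.
  have := @cvg_lim _ (@Rhausdorff R) _ _ FF _ _ S_cvg'.
  rewrite (@cvg_lim _ (@Rhausdorff R) _ _ FF _ _ S_cvg) => /eqP.
  rewrite -subr_eq0 => /eqP E.
  have /eqP : (P - chi 0 - alpha) * (right_limit f t - left_limit f t) = 0.
    by rewrite -[RHS]E (_ : N = 1 - P); [ring | lra].
  rewrite mulf_eq0 => /orP[/eqP|/eqP]; first lra.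
  by move=> /subr0_eq.
(* This is [P + N = 1], that is [sum1]. *)
- lra.
- move=> NE; have PE : P = alpha + chi 0 by lra.
  by rewrite -PE -NE.
Qed.
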